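(* Fix integers $n,m,k$ such that $n/2\ge m>k>0$. Every communication protocol for the Pattern Matching with Edits problem uses $\Omega(n/m\cdot k\log(m/k))$ bits for $P=\mathtt{0}^m$ and some $T\in\{\mathtt{0},\mathtt{1}\}^n$.
   Context: The Pattern Matching with Edits problem: given a pattern $P$ of length $m$, a text $T$ of length $n$, and an integer threshold $k>0$, output $\mathrm{Occ}^E_k(P,T)=\{i\in[0,n] : \exists j\in[i,n],\ \delta_E(P,T[i..j))\le k\}$, where $T[i..j)=T[i]\cdots T[j-1]$ and $\delta_E$ is the edit (Levenshtein) distance, i.e., the minimum number of character insertions, deletions and substitutions transforming one string into the other. A communication protocol here is one-way: Alice knows the input and sends a message to Bob, who must output $\mathrm{Occ}^E_k(P,T)$ from the message alone; the claim is that for some text $T\in\{\mathtt{0},\mathtt{1}\}^n$ (with $P=\mathtt{0}^m$) the message has $\Omega(n/m\cdot k\log(m/k))$ bits. *)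

(* Defs.v *)
From HB Require Import structures.
From mathcomp Require Import all_boot all_order all_algebra.
From mathcomp Require Import boolp reals.

Set Implicit Arguments.
Unset Strict Implicit.
Unset Printing Implicit Defensive.

Section EditDistance.
Variable A : Type.
Implicit Types s t u v : seq A.

Inductive edit_step : seq A -> seq A -> Prop :=
| edit_insertion u v (a : A) : edit_step (u ++ v) (u ++ a :: v)
| edit_deletion u v (a : A) : edit_step (u ++ a :: v) (u ++ v)
| edit_substitution u v (a b : A) : edit_step (u ++ a :: v) (u ++ b :: v).

Fixpoint edits (d : nat) s t : Prop :=
  if d is d'.+1 then exists2 r, edit_step s r & edits d' r t else s = t.

Lemma edits_trans d d' s t r : edits d s t -> edits d' t r -> edits (d + d') s r.
Proof.
elim: d s => [s -> //|d IH] s /= [s' ss' s't] tr.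
by exists s' => //; apply: IH.
Qed.

Lemma edits_to_nil s : edits (size s) s [::].
Proof.
by elim: s => //= a s IH; exists s => //; apply: (edit_deletion [::] s a).
Qed.

Lemma edits_from_nil s : edits (size s) [::] s.
Proof.
elim/last_ind: s => //= s a IH; rewrite size_rcons -addn1.
apply: edits_trans IH _; exists (rcons s a) => //.
by have := edit_insertion s [::] a; rewrite cats0 cats1.
Qed.

Lemma edits_exists s t : exists d, `[< edits d s t >].
Proof.
exists (size s + size t); apply/asboolP.
exact: edits_trans (edits_to_nil s) (edits_from_nil t).
Qed.

Definition edit_distance s t : nat := ex_minn (edits_exists s t).

Definition fragment t (i j : nat) : seq A := take (j - i) (drop i t).

(* 'I_n.+1 is the set of positions [0, n]. *)
Definition OccE (k m n : nat) (P : m.-tuple A) (T : n.-tuple A) :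
    {set 'I_n.+1} :=
  [set i : 'I_n.+1 | [exists j : 'I_n.+1,
     (i <= j) && (edit_distance P (fragment T i j) <= k)]].

End EditDistance.

(* A deterministic one-way protocol. It may depend on m, n and k, which are
   thus known to Bob for free; messages may have variable length and need not
   form a prefix-free code. *)
Record pme_protocol (A : Type) (k m n : nat) := PMEProtocol {
  alice : m.-tuple A -> n.-tuple A -> seq bool;
  bob : seq bool -> {set 'I_n.+1};
  protocol_correct : forall (P : m.-tuple A) (T : n.-tuple A),
    bob (alice P T) = OccE k P T
}.

(* Main.v *)
(** Since the pattern is [0^m], a position [i <= n - m] is an occurrence exactly
    when the window [T[i..i+m)] contains at most [k] ones.  Write the text as
    [n / 2m] pairs [X Y] of words of length [m], each with [k] ones.  Both words
    start with [u] cells of length [q] carrying a single one each, and end with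
    the same padding.  In [X] the one is at the end of every cell; in [Y] it is
    at a freely chosen place [a] of the cell.  As the window slides over a cell,
    it holds [k] ones up to offset [a] and [k + 1] ones after it, so the
    occurrences reveal every [a], and there are [q ^ (u * (n / 2m))] distinct
    answers.  Take [q = m / k], [u = k] if [2 k <= m], and [q = 2], [u = m - k]
    (padding with ones) otherwise. *)
Require Import Defs.
From HB Require Import structures.
From mathcomp Require Import all_boot all_order all_algebra.
From mathcomp Require Import boolp reals exp.
From mathcomp Require Import zify ring lra.
Import Order.TTheory GRing.Theory Num.Theory.

Set Implicit Arguments.
Unset Strict Implicit.
Unset Printing Implicit Defensive.

(** * Edit distance to a power of one letter *)

Lemma edit_step_count (A : Type) (p : pred A) (s t : seq A) :
  edit_step s t -> count p t <= (count p s).+1 /\ count p s <= (count p t).+1.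
Proof.
case=> [u v a|u v a|u v a b]; rewrite !count_cat /=; have := leq_b1 (p a).
- by lia.
- by lia.
- by have := leq_b1 (p b); lia.
Qed.

Lemma edits_count (A : Type) (p : pred A) (d : nat) (s t : seq A) :
  edits d s t -> count p t <= count p s + d /\ count p s <= count p t + d.
Proof.
elim: d s => [s -> | d IHd s /= [r sr /IHd]]; first by rewrite addn0.
by case: (edit_step_count p sr); lia.
Qed.

Lemma edit_step_cons (A : Type) (a : A) (s t : seq A) :
  edit_step s t -> edit_step (a :: s) (a :: t).
Proof.
case=> [u v b|u v b|u v b c]; rewrite -!cat_cons.
- exact: edit_insertion.
- exact: edit_deletion.
- exact: edit_substitution.
Qed.

Lemma edits_cons (A : Type) (a : A) (d : nat) (s t : seq A) :
  edits d s t -> edits d (a :: s) (a :: t).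
Proof.
elim: d s => [s -> // | d IHd s /= [r sr rt]].
by exists (a :: r); [apply: edit_step_cons | apply: IHd].
Qed.

Lemma edits_nseq (A : eqType) (z : A) (s : seq A) :
  edits (count (predC1 z) s) (nseq (size s) z) s.
Proof.
elim: s => //= b s IHs; have [->|_] /= := eqVneq b z; first exact: edits_cons.
exists (b :: nseq (size s) z); last exact: edits_cons.
exact: (edit_substitution [::]).
Qed.

Lemma edit_distance_leP (A : Type) (s t : seq A) (k : nat) :
  reflect (exists2 d, d <= k & edits d s t) (edit_distance s t <= k).
Proof.
rewrite /edit_distance; case: ex_minnP => d /asboolP sd dmin.
apply: (iffP idP) => [dk|[e ek se]]; first by exists d.
exact/(leq_trans _ ek)/dmin/asboolP.
Qed.

(** A fragment of length at least [m] contains the window, and each of its letters other than [z]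
    costs an edit. A shorter fragment has no more [z] than the window, and each [z] missing from the
    [m] of the pattern costs an edit. Conversely, substitutions turn the pattern into the window
    itself. *)
Lemma OccE_nseq (A : eqType) (k m n : nat) (z : A) (T : n.-tuple A)
    (i : 'I_n.+1) : i + m <= n ->
  (i \in OccE k [tuple of nseq m z] T) =
  (count (predC1 z) (fragment T i (i + m)) <= k).
Proof.
move=> imn; rewrite inE; apply/existsP/idP => [[j /andP[ij]]|le_k].
  case/edit_distance_leP => d dk ed; apply: leq_trans _ dk.
  have szi : size (drop i T) = n - i by rewrite size_drop size_tuple.
  have [_] := edits_count (pred1 z) ed; have [+ _] := edits_count (predC1 z) ed.
  rewrite /= !count_nseq /= eqxx mul0n mul1n add0n /fragment addKn.
  set w := drop i T in szi *.
  have [mj le_d _|jm _ le_m] := leqP m (j - i).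
    apply: leq_trans le_d; rewrite -(cat_take_drop m (take (j - i) w)).
    by rewrite count_cat take_takel // leq_addr.
  have szm : size (take m w) = m by rewrite size_takel // szi; lia.
  have le_z : count (pred1 z) (take (j - i) w) <= count (pred1 z) (take m w).
    rewrite -(take_takel w (ltnW jm)) -{2}(cat_take_drop (j - i) (take m w)).
    by rewrite count_cat leq_addr.
  have := count_predC (pred1 z) (take m w); rewrite szm.
  by rewrite [count (predC _) _](eq_count (a2 := predC1 z)) //; lia.
exists (inord (i + m)); rewrite inordK ?ltnS // leq_addr /=.
apply/edit_distance_leP; exists (count (predC1 z) (fragment T i (i + m))) => //.
have szF : size (fragment T i (i + m)) = m.
  by rewrite /fragment addKn size_takel // size_drop size_tuple; lia.
by have := edits_nseq z (fragment T i (i + m)); rewrite szF.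
Qed.

(** * Counting ones in windows of cell words *)

Definition word_tuple (A : Type) (zero one : A) (n : nat) (w : pred nat) :
  n.-tuple A := [tuple if w i then one else zero | i < n].

Lemma count_fragment_word (A : eqType) (zero one : A) (n i m : nat)
    (w : pred nat) : zero != one -> i + m <= n ->
  count (predC1 zero) (fragment (word_tuple zero one n w) i (i + m)) =
  \sum_(i <= p < i + m) w p.
Proof.
move=> neq imn; rewrite /fragment addKn -(map_nth_iota zero); last first.
  by rewrite size_tuple; lia.
rewrite count_map -sum1_count big_mkcond /index_iota addKn /=.
rewrite big_seq [RHS]big_seq; apply: eq_bigr => p; rewrite mem_iota => pP.
have pn : p < n by lia.
rewrite -[p in nth _ _ p]/(val (Ordinal pn)) nth_mktuple /=.
by case: (w p); rewrite /= ?eqxx // eq_sym neq.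
Qed.

Definition cell_word (q u r : nat) (h : nat -> nat) : pred nat :=
  fun t => if t < u * q then t %% q == h (t %/ q) else t < u * q + r.

Lemma sum_eq_nat (h o : nat) : \sum_(0 <= p < o) (p == h) = (h < o).
Proof.
elim: o => [|o IHo]; first by rewrite big_geq.
by rewrite big_nat_recr //= IHo; case: eqVneq; lia.
Qed.

Lemma sum_nat_lt (r l : nat) : r <= l -> \sum_(0 <= p < l) (p < r) = r.
Proof.
move=> rl; rewrite (big_cat_nat (n := r)) //=.
rewrite (eq_big_nat _ _ (F2 := fun=> 1)); last by move=> p /andP[_ ->].
rewrite [X in _ + X](eq_big_nat _ _ (F2 := fun=> 0)); last first.
  by move=> p /andP[rp _]; rewrite ltnNge rp.
by rewrite !sum_nat_const_nat; lia.
Qed.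

Lemma sum_nat_shift (F : nat -> nat) (a l : nat) :
  \sum_(a <= p < a + l) F p = \sum_(0 <= p < l) F (a + p).
Proof.
rewrite -{1}[a]add0n big_addn addKn.
by apply: eq_bigr => p _; rewrite addnC.
Qed.

Lemma sum_cell_word (q u r : nat) (h : nat -> nat) (c o : nat) :
  (forall i, h i < q) -> o <= q -> c * q + o <= u * q ->
  \sum_(0 <= p < c * q + o) cell_word q u r h p = c + (h c < o).
Proof.
move=> hq; have q0 : 0 < q by apply: leq_ltn_trans (hq 0).
elim: c o => [|c IHc] o oq le_u.
  rewrite add0n -sum_eq_nat.
  apply: eq_big_nat => p /andP[_ po]; rewrite /cell_word ifT; last by lia.
  by rewrite modn_small ?divn_small //; apply: leq_trans oq.
rewrite (big_cat_nat (n := c.+1 * q)) ?leq_addr //= sum_nat_shift.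
(* Completed cells are handled by the induction hypothesis at offset [q], hence the bound [o <= q];
   by [hq] a full cell always counts one. *)
rewrite {1}mulSn [q + _]addnC IHc //; last by rewrite mulSn in le_u; lia.
rewrite hq addn1; congr (_ + _); rewrite -sum_eq_nat.
apply: eq_big_nat => p /andP[_ po]; rewrite /cell_word ifT; last by lia.
have pq : p < q by apply: leq_trans oq.
by rewrite modnMDl divnMDl // modn_small ?divn_small ?addn0.
Qed.

Lemma sum_cell_word_total (q u r m : nat) (h : nat -> nat) :
  (forall i, h i < q) -> u * q + r <= m ->
  \sum_(0 <= p < m) cell_word q u r h p = u + r.
Proof.
move=> hq le_m; rewrite (big_cat_nat (n := u * q)) //=; last by lia.
rewrite -{1}[u * q]addn0 sum_cell_word ?addn0 //; congr (_ + _).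
rewrite -{1}(subnKC (leq_trans (leq_addr r _) le_m)) sum_nat_shift.
rewrite -{2}(@sum_nat_lt r (m - u * q)); last by lia.
apply: eq_bigr => p _; rewrite /cell_word ltnNge leq_addr /=.
by rewrite ltn_add2l.
Qed.

Definition text_word (m q u r : nat) (a : nat -> nat -> nat) : pred nat :=
  fun p => let t := p %% (2 * m) in
    if t < m then cell_word q u r (fun=> q.-1) t
    else cell_word q u r (a (p %/ (2 * m))) (t - m).

(** The window has lost the first [t = c * q + o] letters of the X word and gained the first [t]
    letters of the Y word, so its sum is the total of X minus one prefix sum plus another. *)
Lemma sum_text_word (m q u r : nat) (a : nat -> nat -> nat) (j c o : nat) :
  (forall i l, a i l < q) -> u * q + r <= m -> c < u -> o < q ->
  let i := j * (2 * m) + (c * q + o) in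
  \sum_(i <= p < i + m) text_word m q u r a p = u + r + (a j c < o).
Proof.
move=> aq le_m cu oq; set t := c * q + o.
have tu : t < u * q.
  have: c.+1 * q <= u * q by rewrite leq_mul2r cu orbT.
  by rewrite mulSn /t; lia.
have q1 (i : nat) : (fun=> q.-1) i < q by rewrite prednK //; lia.
rewrite /= sum_nat_shift (big_cat_nat (n := m - t)) /=; [|by []|lia].
(* As [o < q], the one closing cell [c] of X is still inside the window. *)
have sumX : \sum_(0 <= p < t) cell_word q u r (fun=> q.-1) p = c.
  by rewrite sum_cell_word //; lia.
have sumY : \sum_(0 <= p < t) cell_word q u r (a j) p = c + (a j c < o).
  by rewrite sum_cell_word //; lia.
have := sum_cell_word_total q1 le_m.
rewrite (big_cat_nat (n := t)) /=; [|by []|lia].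
rewrite sumX => totX.
rewrite (eq_big_nat _ _
  (F2 := fun p => cell_word q u r (fun=> q.-1) (t + p) : nat)); last first.
  move=> p /andP[_ pm]; rewrite /text_word -addnA modnMDl modn_small; last by lia.
  by rewrite ifT //; lia.
rewrite -(sum_nat_shift (cell_word q u r (fun=> q.-1))) subnKC; last by lia.
rewrite (_ : \sum_(m - t <= p < m) _ = c + (a j c < o)); first by lia.
rewrite -sumY -{2}[m](@subnK t); last by lia.
rewrite sum_nat_shift; apply: eq_big_nat => p /andP[_ pt].
rewrite /text_word -addnA modnMDl divnMDl; last by lia.
have -> : t + (m - t + p) = m + p by lia.
by rewrite modn_small ?divn_small; [rewrite ifF ?addn0 ?addKn //; lia | lia | lia].
Qed.

(** * Texts recovered from their occurrences *)

(** The successors make the index types inhabited, as [inord] requires. Past the last full pair the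
    default value of [inord] fills the text; no window used below reaches that far. *)
Definition cell_text (A : Type) (zero one : A) (n m r : nat) (b u q : nat)
    (f : {ffun 'I_b.+1 * 'I_u.+1 -> 'I_q}) : n.-tuple A :=
  word_tuple zero one n
    (text_word m q u.+1 r (fun j c => f (inord j, inord c))).

Lemma cell_text_subset (A : eqType) (zero one : A) (n m r b u q : nat)
    (f : {ffun 'I_b.+1 * 'I_u.+1 -> 'I_q}) :
  {subset cell_text zero one n m r f <= [:: zero; one]}.
Proof.
move=> x /tnthP[i ->]; rewrite tnth_mktuple.
by case: ifP; rewrite !inE eqxx ?orbT.
Qed.

Lemma OccE_cell_text (A : eqType) (zero one : A) (n m r b u q : nat)
    (f : {ffun 'I_b.+1 * 'I_u.+1 -> 'I_q}) (j : 'I_b.+1) (c : 'I_u.+1) (o : nat) :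
  zero != one -> b.+1 * (2 * m) <= n -> u.+1 * q + r <= m -> o < q ->
  (inord (j * (2 * m) + (c * q + o))
     \in OccE (u.+1 + r) [tuple of nseq m zero] (cell_text zero one n m r f))
  = (o <= f (j, c)).
Proof.
move=> neq le_n le_m oq; set i := j * _ + _.
have le_i : i + m <= n.
  have : c.+1 * q <= u.+1 * q by rewrite leq_mul2r ltn_ord orbT.
  have : j.+1 * (2 * m) <= b.+1 * (2 * m) by rewrite leq_mul2r ltn_ord orbT.
  by rewrite !mulSn in le_n le_m *; rewrite /i; lia.
have iK : (inord i : 'I_n.+1) = i :> nat by rewrite inordK //; lia.
rewrite OccE_nseq iK // count_fragment_word // sum_text_word //.
by rewrite !inord_val; case: ltnP; lia.
Qed.

Lemma OccE_cell_text_inj (A : eqType) (zero one : A) (n m r b u q : nat) :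
  zero != one -> b.+1 * (2 * m) <= n -> u.+1 * q + r <= m ->
  injective (fun f : {ffun 'I_b.+1 * 'I_u.+1 -> 'I_q} =>
    OccE (u.+1 + r) [tuple of nseq m zero] (cell_text zero one n m r f)).
Proof.
move=> neq le_n le_m f g eq_fg; apply/ffunP => -[j c]; apply/val_inj/eqP.
have occ o : o < q -> (o <= f (j, c)) = (o <= g (j, c)).
  by move=> oq; rewrite -!(OccE_cell_text _ _ _ neq le_n le_m oq) [OccE _ _ _]eq_fg.
(* Both values are below [q], so each serves as a test offset for the other. *)
by rewrite eqn_leq /= -(occ _ (ltn_ord _)) (occ _ (ltn_ord (g _))) !leqnn.
Qed.

(** * Counting messages *)

(* Appending [true] before padding keeps the length of the string recoverable. *)
Lemma card_short_bitseq (I : finType) (l : nat) (f : I -> seq bool) :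
  injective f -> (forall i, size (f i) <= l) -> #|I| <= 2 ^ l.+1.
Proof.
move=> f_inj f_le; pose pad s := rcons s true ++ nseq (l - size s) false.
have pad_inj s t : pad s = pad t -> s = t.
  rewrite /pad => /(congr1 rev); rewrite !rev_cat !rev_nseq !rev_rcons.
  move: (l - size s) (l - size t) => x y.
  elim: x y => [|x IHx] [|y] //=; last by case=> /IHx.
  by case=> /(can_inj revK).
have sz i : size (pad (f i)) == l.+1.
  by rewrite size_cat size_rcons size_nseq addSn subnKC.
have: injective (fun i => Tuple (sz i)).
  by move=> i j /(congr1 val) /pad_inj /f_inj.
by move/leq_card; rewrite card_tuple card_bool.
Qed.

(** The index [i] has a longest message, of length [l] say. The count gives [2 ^ l.+1], and
    [l.+1 <= 2 * l] unless [l = 0]; in that case all messages are empty, so injectivity leaves a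
    single index. *)
Lemma protocol_pigeonhole (A : Type) (k m n : nat) (pi : pme_protocol A k m n)
    (P : m.-tuple A) (I : finType) (T : I -> n.-tuple A) :
  injective (fun i => OccE k P (T i)) -> 1 < #|I| ->
  exists i, #|I| <= 2 ^ (2 * size (alice pi P (T i))).
Proof.
move=> T_inj I_gt1.
have msg_inj : injective (fun i => alice pi P (T i)).
  by move=> i j eq_ij; apply: T_inj; rewrite -!(protocol_correct pi) eq_ij.
have /card_gt0P[i0 _] : 0 < #|I| by apply: ltnW.
case: (@arg_maxnP _ i0 xpredT (fun i => size (alice pi P (T i)))) => // i _ imax.
exists i; have le_I := card_short_bitseq msg_inj (fun j => imax j isT).
case: (posnP (size (alice pi P (T i)))) => [sz0|sz_gt0].
  suff : #|I| <= 1 by rewrite leqNgt I_gt1.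
  apply/card_le1P => x _ y; rewrite !inE; apply/esym/eqP/msg_inj => /=.
  have msg0 j : alice pi P (T j) = [::].
    by apply/size0nil/eqP; rewrite -leqn0 -sz0; apply: imax.
  by rewrite !msg0.
by apply: leq_trans le_I _; rewrite leq_exp2l //; lia.
Qed.

(** * Choice of parameters and the final estimate *)

Local Open Scope ring_scope.

(** This is [ln (1 + x) <= x] at [x = - 1/2]. *)
Lemma ln2_ge_half (R : realType) : 2^-1 <= ln 2 :> R.
Proof.
have := @le_ln1Dx R (- 2^-1); rewrite (_ : 1 + - 2^-1 = 2^-1); last by field.
by rewrite lnV ?posrE //; lra.
Qed.

Lemma ln_natX (R : realType) (a e : nat) : (0 < a)%N ->
  ln (a ^ e)%N%:R = e%:R * ln a%:R :> R.
Proof. by move=> a0; rewrite natrX lnXn ?ltr0n // mulr_natl. Qed.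

Lemma cell_parameters (R : realType) (m k : nat) : (0 < k)%N -> (k < m)%N ->
  exists u q r : nat, [/\ (1 < q)%N, (u.+1 * q + r <= m)%N, k = (u.+1 + r)%N &
    k%:R * ln (m%:R / k%:R) <= 2 * (u.+1%:R * ln q%:R) :> R].
Proof.
move=> k0 km; have k0R : 0 < k%:R :> R by rewrite ltr0n.
have m0R : 0 < m%:R :> R by rewrite ltr0n; lia.
have [k2m|m2k] := leqP (2 * k) m.
  have q2 : (1 < m %/ k)%N by rewrite leq_divRL.
  exists k.-1, (m %/ k)%N, 0%N; rewrite prednK // !addn0; split => //.
    by rewrite mulnC leq_divM.
  rewrite mulrCA ler_pM2l // [2 * _]mulr_natl -lnXn; last by rewrite ltr0n; lia.
  rewrite ler_ln ?posrE ?divr_gt0 ?exprn_gt0 ?ltr0n //; try lia.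
  rewrite ler_pdivrMr // -natrX -natrM ler_nat.
  (* With [q = m %/ k >= 2], [m / k < q + 1 <= q ^ 2], which the factor 2 in front of the logarithm
     absorbs. *)
  have := ltn_ceil m k0; move: (m %/ k)%N q2 => q q2.
  have : (q.+1 * k <= q ^ 2 * k)%N by rewrite leq_mul2r; apply/orP; right; nia.
  by lia.
(* The [m - k] cells of length 2 and the [2k - m] padding ones fill the word exactly and hold [k]
   ones. *)
exists (m - k).-1, 2%N, (k - (m - k))%N; rewrite prednK ?subn_gt0 //.
split => //; try lia.
have le_u : k%:R * ln (m%:R / k%:R) <= (m - k)%N%:R :> R.
  rewrite mulrC -ler_pdivlMr // natrB; last by lia.
  have -> : (m%:R - k%:R) / k%:R = m%:R / k%:R - 1 :> R.
    by rewrite mulrBl divff // gt_eqF.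
  rewrite -{1}[m%:R / k%:R](subrKC 1); apply: le_ln1Dx.
  have : 0 < m%:R / k%:R :> R by rewrite divr_gt0.
  by lra.
apply: le_trans le_u _; rewrite mulrCA ler_peMr ?ler0n //.
by have := ln2_ge_half R; lra.
Qed.

Theorem theorem2 (R : realType) :
  exists2 c : R, 0 < c &
    forall (A : eqType) (zero one : A), zero != one ->
    forall n m k : nat, (2 * m <= n)%N -> (k < m)%N -> (0 < k)%N ->
    forall pi : pme_protocol A k m n,
    exists2 T : n.-tuple A, {subset T <= [:: zero; one]} &
      c * (n%:R / m%:R * (k%:R * ln (m%:R / k%:R)))
        <= (size (alice pi [tuple of nseq m zero] T))%:R.
Proof.
(* 16 = 4 * 2 * 2: rounding [n / m] to whole pairs, the loss in [cell_parameters], and the doubled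
   message length. *)
exists 16^-1; first by rewrite invr_gt0.
move=> A zero one neq n m k mn km k0 pi.
have [u [q [r [q1 le_m eq_k le_q]]]] := cell_parameters R k0 km.
rewrite {}eq_k in pi km k0 le_q *.
have m0 : (0 < 2 * m)%N by lia.
have b0 : (0 < n %/ (2 * m))%N by rewrite divn_gt0.
set b := (n %/ (2 * m)).-1.
have eq_b : b.+1 = (n %/ (2 * m))%N by rewrite prednK.
have le_n : (b.+1 * (2 * m) <= n)%N by rewrite eq_b leq_divM.
have lt_n : (n < b.+2 * (2 * m))%N by rewrite eq_b ltn_ceil.
have inj := OccE_cell_text_inj (r := r) (u := u) (q := q) neq le_n le_m.
have cardE : #|{ffun 'I_b.+1 * 'I_u.+1 -> 'I_q}| = (q ^ (b.+1 * u.+1))%N.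
  by rewrite card_ffun card_prod !card_ord.
have [] := protocol_pigeonhole pi inj.
  by rewrite cardE -{1}(expn0 q) ltn_exp2l // muln_gt0.
move=> f; rewrite cardE; set s := size _ => le_s.
exists (cell_text zero one n m r f); first exact: cell_text_subset.
rewrite -/s.
(* Take logarithms in [le_s] and use [ln 2 <= 1]. *)
have le_sR : b.+1%:R * (u.+1%:R * ln q%:R) <= 2 * s%:R :> R.
  have : ln ((q ^ (b.+1 * u.+1))%N%:R) <= ln ((2 ^ (2 * s))%N%:R) :> R.
    by rewrite ler_ln ?posrE ?ltr0n ?expn_gt0 ?ler_nat //; lia.
  rewrite !ln_natX ?(ltnW q1) // !natrM -mulrA => /le_trans; apply.
  rewrite ler_piMr ?mulr_ge0 //.
  by have := @le_ln1Dx R 1; rewrite -[1 + 1]/2; apply; lra.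
have mR : 0 < m%:R :> R by rewrite ltr0n; lia.
(* Here [n < (b + 2) * 2m], and [b + 2 <= 2 * (b + 1)]. *)
have le_nm : n%:R / m%:R <= 4 * b.+1%:R :> R.
  rewrite ler_pdivrMr // -!natrM ler_nat.
  by apply: ltnW; apply: leq_trans lt_n _; rewrite mulnA leq_mul2r; lia.
set L := _ * ln _ in le_q *.
have L0 : 0 <= L.
  rewrite mulr_ge0 // ln_ge0 // ler_pdivlMr ?ltr0n // mul1r ler_nat.
  exact: ltnW.
have le1 := ler_wpM2r L0 le_nm.
have le2 : 4 * b.+1%:R * L <= 4 * b.+1%:R * (2 * (u.+1%:R * ln q%:R)).
  by rewrite ler_wpM2l // mulr_ge0.
rewrite mulrC ler_pdivrMr //; apply: le_trans le1 _; apply: le_trans le2 _.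
have -> : 4 * b.+1%:R * (2 * (u.+1%:R * ln q%:R)) =
  8 * (b.+1%:R * (u.+1%:R * ln q%:R)) :> R by ring.
by move: le_sR; set x := _ * (_ * _); lra.
Qed.
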